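(* The theories $\mathrm{STT}^{\downarrow}$ and $\mathrm{FJT}$ are definitionally equivalent.
   Context: $\mathrm{FJT}$: types $n<\omega$; $b^n(a^m)$ well-formed iff $m<n$; identity only between same-type terms (usual identity rules); classical logic with quantifier rules that instantiate/generalise only at the same type (from $\forall x^n\phi(x^n)$ infer $\phi(a^n)$; from $\phi(b^n)$, with $b^n$ not in undischarged assumptions, infer $\forall x^n\phi(x^n)$); FJT-Comprehension: for each $n>0$, $\exists z^n\bigwedge_{i<n}\forall x^i(z^n(x^i)\leftrightarrow\phi_i(x^i))$, whenever each $\phi_i(x^i)$ is well-formed and does not contain $z^n$. $\mathrm{STT}$: types $n<\omega$; $b^n(a^m)$ well-formed iff $n=m+1$; identity only between same-type terms; same-type quantifier rules; Comprehension $\exists z^{n+1}\forall x^n(z^{n+1}(x^n)\leftrightarrow\phi(x^n))$; identity scheme $x^n=y^n\leftrightarrow\forall z^{n+1}(z^{n+1}(x^n)\leftrightarrow z^{n+1}(y^n))$. $\mathrm{STT}^{\downarrow}$ augments $\mathrm{STT}$ with, for each $n>0$, a binary relation symbol $\rightsquigarrow$ relating a type-$(n+1)$ term to a type-$n$ term. Abbreviations: $a^n\simeq b^n:\Leftrightarrow\forall x^{n-1}(a^n(x^{n-1})\leftrightarrow b^n(x^{n-1}))$ for $n>0$; $a^n\approx b^n:\Leftrightarrow\forall x^{n-1}(a^n\rightsquigarrow x^{n-1}\leftrightarrow b^n\rightsquigarrow x^{n-1})$ for $n>1$, and $a^1\approx b^1$ always true. Axioms of $\mathrm{STT}^\downarrow$: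 $\exists z^1\forall x^0(z^1(x^0)\leftrightarrow\phi(x^0))$; for each $n\ge1$, $\forall y^n\exists z^{n+1}(z^{n+1}\rightsquigarrow y^n\wedge\forall x^n(z^{n+1}(x^n)\leftrightarrow\phi(x^n)))$ for $\phi$ not containing $z^{n+1}$; and for each $n>0$: Down$_\exists$ $\forall z^{n+1}\exists x^n\,z^{n+1}\rightsquigarrow x^n$; Down$_{\mathrm{Sim}}$ $\forall z^{n+1}\forall x^n\forall y^n((z^{n+1}\rightsquigarrow x^n\wedge z^{n+1}\rightsquigarrow y^n)\to(x^n\simeq y^n\wedge y^n\approx x^n))$; Down$_{\mathrm{Max}}$ $\forall z^{n+1}\forall x^n\forall y^n((z^{n+1}\rightsquigarrow x^n\wedge x^n\simeq y^n\wedge y^n\approx x^n)\to z^{n+1}\rightsquigarrow y^n)$. Two theories are definitionally equivalent iff there are interpretations (type-respecting translations preserving logical vocabulary and taking theorems to theorems) $I$ from the first to the second and $J$ from the second to the first such that each theory proves every atomic formula of its language equivalent to its translation under the composite of the two interpretations. *)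

(* Defs.v *)
From Stdlib Require List.
From mathcomp Require Import all_boot.

Set Implicit Arguments.
Unset Strict Implicit.
Unset Printing Implicit Defensive.

(** * Languages

    Every type [n < omega] has its own supply of variables, the only terms; free
    variables serve as the parameters a^n, b^n of the quantifier rules.  All the
    non-logical symbols needed are binary, so a language is given by its symbols
    and the types of their two places. *)

Record language := Language {
  symbol : Type;
  type1 : symbol -> nat;
  type2 : symbol -> nat
}.

(** Variables are de Bruijn indices, counted separately at each type: [All n f]
    binds index 0 of type [n] in [f], shifts the other indices of type [n], and
    leaves the indices of every other type unchanged.  In [Eq n i j] the indices
    [i], [j] are of type [n]; in [Pred p i j] the index [i] is of type [type1 p]
    and [j] of type [type2 p].  Hence every term of type [form L] is a well-formed
    formula. *)

Inductive form (L : language) : Type :=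
| Bot
| Imp of form L & form L
| All of nat & form L
| Eq of nat & nat & nat
| Pred of symbol L & nat & nat.

Arguments Bot {L}.
Arguments Eq {L}.

Section Formulas.
Variable L : language.
Implicit Types f g : form L.

Definition Neg f := Imp f Bot.
Definition Top : form L := Imp Bot Bot.
Definition And f g := Neg (Imp f (Neg g)).
Definition Iff f g := And (Imp f g) (Imp g f).
Definition Ex n f := Neg (All n (Neg f)).

Definition atomic f : bool :=
  match f with Eq _ _ _ | Pred _ _ _ => true | _ => false end.

(** A renaming [r] sends the variable [i] of type [k] to the variable [r k i] of
    type [k]. *)
Definition up (n : nat) (r : nat -> nat -> nat) : nat -> nat -> nat :=
  fun k i => if k == n then (if i is i'.+1 then (r k i').+1 else 0) else r k i.

Fixpoint ren (r : nat -> nat -> nat) f : form L :=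
  match f with
  | Bot => Bot
  | Imp f g => Imp (ren r f) (ren r g)
  | All n f => All n (ren (up n r) f)
  | Eq n i j => Eq n (r n i) (r n j)
  | Pred p i j => Pred p (r (type1 p) i) (r (type2 p) j)
  end.

(** [shift n f] does not contain the variable 0 of type [n]. *)
Definition shift (n : nat) f : form L :=
  ren (fun k i => if k == n then i.+1 else i) f.

(** [inst n a f] is phi(a^n), where [f] is phi(x^n) with [x] the variable 0 of
    type [n]. *)
Definition inst (n a : nat) f : form L :=
  ren (fun k i => if k == n then (if i is i'.+1 then i' else a) else i) f.

End Formulas.

Arguments Top {L}.

(** * Theories and provability

    [identity_rules] tells whether the rules of identity belong to the underlying
    logic, or identity is governed by the axioms alone. *)

Record theory := Theory {
  lang :> language;
  identity_rules : bool;
  axiom : form lang -> Prop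
}.

(** In [prf_allI] the variable 0 of type [n] plays the role of the parameter b^n:
    shifting the assumptions makes it fresh for them.  Axioms are not assumptions,
    so an axiom set is meant to be closed under renaming of variables. *)
Inductive prf (T : theory) : seq (form T) -> form T -> Prop :=
| prf_hyp G f : List.In f G -> prf G f
| prf_axiom G f : axiom f -> prf G f
| prf_impI G f g : prf (f :: G) g -> prf G (Imp f g)
| prf_impE G f g : prf G (Imp f g) -> prf G f -> prf G g
| prf_raa G f : prf (Neg f :: G) Bot -> prf G f
| prf_allI G n f : prf (map (shift n) G) f -> prf G (All n f)
| prf_allE G n a f : prf G (All n f) -> prf G (inst n a f)
| prf_eqI G n a : identity_rules T -> prf G (Eq n a a)
| prf_eqE G n a b f : identity_rules T ->
    prf G (Eq n a b) -> prf G (inst n a f) -> prf G (inst n b f).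

Definition provable (T : theory) (f : form T) : Prop := @prf T [::] f.
Arguments provable : clear implicits.

(** * Definitional equivalence *)

(** Identity counts as logical vocabulary.  [tr_ren] says that the translation of
    an atomic formula is uniform in its variables and has no further free
    variables. *)
Record translation (L1 L2 : language) (I : form L1 -> form L2) : Prop := {
  tr_bot : I Bot = Bot;
  tr_imp : forall f g, I (Imp f g) = Imp (I f) (I g);
  tr_all : forall n f, I (All n f) = All n (I f);
  tr_eq : forall n i j, I (Eq n i j) = Eq n i j;
  tr_ren : forall r f, I (ren r f) = ren r (I f)
}.

Definition interpretation (T1 T2 : theory) (I : form T1 -> form T2) : Prop :=
  translation I /\ forall f, provable T1 f -> provable T2 (I f).

Definition definitionally_equivalent (T1 T2 : theory) : Prop :=
  exists (I : form T1 -> form T2) (J : form T2 -> form T1),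
    [/\ interpretation I,
        interpretation J,
        forall f : form T1, atomic f -> provable T1 (Iff f (J (I f)))
      & forall f : form T2, atomic f -> provable T2 (Iff f (I (J f)))].

(** * FJT *)

(** The symbol [existT _ n m], with [m : 'I_n], is application of a term of type
    [n] to a term of type [m < n]. *)
Definition fjt_language : language :=
  @Language {n : nat & 'I_n} (fun p => projT1 p) (fun p => nat_of_ord (projT2 p)).

Definition fjt_app (n : nat) (m : 'I_n) (b a : nat) : form fjt_language :=
  @Pred fjt_language (existT _ n m) b a.

(** z^n and x^i have different types as [i < n], so both have index 0. *)
Inductive fjt_axiom : form fjt_language -> Prop :=
| fjt_comprehension (n : nat) (phi : 'I_n -> form fjt_language) :
    0 < n ->
    fjt_axiom (Ex n (\big[@And fjt_language/Top]_(i < n)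
                       All i (Iff (fjt_app i 0 0) (shift n (phi i))))).

Definition FJT : theory := @Theory fjt_language true fjt_axiom.

(** * STT with downward relations *)

(** [App n] applies a term of type [n.+1] to a term of type [n]; [Down n] is the
    relation ~> between terms of types [n.+2] and [n.+1]. *)
Inductive stt_symbol : Type := App of nat | Down of nat.

Definition stt_language : language :=
  @Language stt_symbol
    (fun p => match p with App n => n.+1 | Down n => n.+2 end)
    (fun p => match p with App n => n | Down n => n.+1 end).

Definition stt_app (n b a : nat) : form stt_language :=
  @Pred stt_language (App n) b a.

Definition stt_down (n b a : nat) : form stt_language :=
  @Pred stt_language (Down n) b a.

(** [stt_sim n a b] and [stt_approx n a b] relate terms [a], [b] of type [n.+1]. *)
Definition stt_sim (n a b : nat) : form stt_language :=
  All n (Iff (stt_app n a 0) (stt_app n b 0)).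

Definition stt_approx (n a b : nat) : form stt_language :=
  if n is m.+1 then All m.+1 (Iff (stt_down m a 0) (stt_down m b 0)) else Top.

(** In the axioms [stt_comprehension_down], [stt_down_ex], [stt_down_sim] and
    [stt_down_max] the terms z have type [n.+2] and the terms x, y type [n.+1].
    In [stt_comprehension_down], phi has x as variable 0 and y as variable 1 of
    type [n.+1]; in the last two axioms x has index 1 and y index 0. *)
Inductive stt_down_axiom : form stt_language -> Prop :=
| stt_identity n i j :
    stt_down_axiom
      (Iff (Eq n i j) (All n.+1 (Iff (stt_app n 0 i) (stt_app n 0 j))))
| stt_comprehension0 phi :
    stt_down_axiom (Ex 1 (All 0 (Iff (stt_app 0 0 0) (shift 1 phi))))
| stt_comprehension_down n phi :
    stt_down_axiom
      (All n.+1 (Ex n.+2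
         (And (stt_down n 0 0)
              (All n.+1 (Iff (stt_app n.+1 0 0) (shift n.+2 phi))))))
| stt_down_ex n :
    stt_down_axiom (All n.+2 (Ex n.+1 (stt_down n 0 0)))
| stt_down_sim n :
    stt_down_axiom
      (All n.+2 (All n.+1 (All n.+1
         (Imp (And (stt_down n 0 1) (stt_down n 0 0))
              (And (stt_sim n 1 0) (stt_approx n 0 1))))))
| stt_down_max n :
    stt_down_axiom
      (All n.+2 (All n.+1 (All n.+1
         (Imp (And (stt_down n 0 1) (And (stt_sim n 1 0) (stt_approx n 0 1)))
              (stt_down n 0 0))))).

Definition STT_down : theory := @Theory stt_language false stt_down_axiom.

(* Main.v *)
(** Application of a type-[n.+1] term to a type-[n] term is common to both theories.
    A type-[n.+2] term z of FJT moreover has extensions at the types [0..n]; in STT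
    these are recorded by ~>.  So z ~> x is translated as "z and x apply to the same
    terms of every type below that of x", and an application of z that skips types as
    "some x with z ~> x so applies".  That these translations are mutually inverse is
    checked on models: Henkin completeness turns every derivability claim into a
    statement about structures, and translations act on structures by pulling back. *)

From Stdlib Require Import Classical ClassicalEpsilon.
From Stdlib Require List.
From mathcomp Require Import all_boot.
Require Import Defs.

Set Implicit Arguments.
Unset Strict Implicit.
Unset Printing Implicit Defensive.

(** Extends an assignment as [up] extends a renaming; carriers being [nat], it also serves as a
    renaming that substitutes [a]. *)
Definition scons (n a : nat) (e : nat -> nat -> nat) : nat -> nat -> nat :=
  fun k i => if k == n then (if i is i'.+1 then e k i' else a) else e k i.

Definition idr : nat -> nat -> nat := fun _ i => i.

(** * Renaming and derivations *)

Section Renaming.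
Variable L : language.
Implicit Types f g : form L.

(** One strict bound on the indices of all types. Binders do not lower it, so it overestimates the
    free indices, which is enough for freshness. *)
Fixpoint bound f : nat :=
  match f with
  | Bot => 0
  | Imp f g => maxn (bound f) (bound g)
  | All _ f => bound f
  | Eq _ i j | Pred _ i j => (maxn i j).+1
  end.

Lemma ren_ext_bound f r s :
  (forall k i, i < bound f -> r k i = s k i) -> ren r f = ren s f.
Proof.
elim: f r s => [|f IHf g IHg|n f IHf|n i j|p i j] r s //= rs.
- by congr Imp; [apply: IHf|apply: IHg] => k i lti; apply: rs;
    rewrite leq_max lti ?orbT.
- congr All; apply: IHf => k [|i] lti; rewrite /up; case: eqP => // _; rewrite rs //.
  exact: ltnW.
- by rewrite !rs // ltnS ?leq_maxl ?leq_maxr.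
- by rewrite !rs // ltnS ?leq_maxl ?leq_maxr.
Qed.

Lemma ren_ext f r s : (forall k i, r k i = s k i) -> ren r f = ren s f.
Proof. by move=> rs; apply: ren_ext_bound => k i _; apply: rs. Qed.

Lemma ren_comp f r s : ren r (ren s f) = ren (fun k i => r k (s k i)) f.
Proof.
elim: f r s => [|f IHf g IHg|n f IHf|n i j|p i j] r s //=.
- by rewrite IHf IHg.
- rewrite IHf; congr All; apply: ren_ext => k i.
  by rewrite /up; case: eqP => // _; case: i.
Qed.

Lemma ren_id f : ren idr f = f.
Proof.
elim: f => [|f IHf g IHg|n f IHf|n i j|p i j] //=; first by rewrite IHf IHg.
congr All; rewrite -[RHS]IHf; apply: ren_ext => k i.
by rewrite /up; case: eqP => // _; case: i.
Qed.

Lemma ren_shift n r f : ren (up n r) (shift n f) = shift n (ren r f).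
Proof.
rewrite /shift !ren_comp; apply: ren_ext => k i.
by rewrite /up; case: eqP.
Qed.

Lemma ren_inst n a r f : ren r (inst n a f) = inst n (r n a) (ren (up n r) f).
Proof.
rewrite /inst !ren_comp; apply: ren_ext => k i.
by rewrite /up; case: eqP => [->|//]; case: i.
Qed.

Lemma inst_ren_up n a r f : inst n a (ren (up n r) f) = ren (scons n a r) f.
Proof.
rewrite /inst !ren_comp; apply: ren_ext => k i.
by rewrite /up /scons; case: eqP => [->|//]; case: i.
Qed.

Lemma ren_bigAnd (n : nat) (F : 'I_n -> form L) r :
  ren r (\big[@And L/Top]_(i < n) F i) = \big[@And L/Top]_(i < n) ren r (F i).
Proof. exact: (big_morph (ren r)). Qed.

End Renaming.

Definition ren_closed (T : theory) :=
  forall r (f : form T), axiom f -> axiom (ren r f).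

(** * Weakening, renaming and generalisation on a fresh variable *)

Section Provability.
Variable T : theory.
Implicit Types (f g : form T) (G : seq (form T)).

Lemma prf_weaken G G' f :
  prf G f -> (forall g, List.In g G -> List.In g G') -> prf G' f.
Proof.
move=> pf; elim: pf G' => {G f}.
- by move=> G f fG G' sub; apply/prf_hyp/sub.
- by move=> G f ax G' _; apply: prf_axiom.
- move=> G f g _ IH G' sub; apply/prf_impI/IH => h /= [->|/sub]; by [left|right].
- by move=> G f g _ IH1 _ IH2 G' sub; apply: prf_impE (IH1 _ sub) (IH2 _ sub).
- move=> G f _ IH G' sub; apply/prf_raa/IH => h /= [->|/sub]; by [left|right].
- move=> G n f _ IH G' sub; apply/prf_allI/IH => h.
  rewrite !List.in_map_iff => -[h' [<- /sub ?]]; by exists h'.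
- by move=> G n a f _ IH G' sub; apply/prf_allE/IH.
- by move=> G n a idT G' _; apply: prf_eqI.
- by move=> G n a b f idT _ IH1 _ IH2 G' sub; apply: prf_eqE (IH1 _ sub) (IH2 _ sub).
Qed.

Hypothesis T_ren : ren_closed T.

Lemma prf_ren G f r : prf G f -> prf (map (ren r) G) (ren r f).
Proof.
move=> pf; elim: pf r => {G f}.
- by move=> G f fG r; apply/prf_hyp/List.in_map.
- by move=> G f ax r; apply/prf_axiom/T_ren.
- by move=> G f g _ IH r; apply: prf_impI (IH r).
- by move=> G f g _ IH1 _ IH2 r; apply: prf_impE (IH1 r) (IH2 r).
- by move=> G f _ IH r; apply: prf_raa (IH r).
- move=> G n f _ IH r; apply: prf_allI; have := IH (up n r).
  by rewrite -!map_comp (eq_map (ren_shift n r)).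
- by move=> G n a f _ IH r; rewrite ren_inst; apply: prf_allE (IH r).
- by move=> G n a idT r; apply: prf_eqI.
- move=> G n a b f idT _ IH1 _ IH2 r; rewrite ren_inst.
  by apply: prf_eqE (IH1 r) _ => //; rewrite -ren_inst.
Qed.

(** The rule for a named parameter [c], recovered from the de Bruijn rule by renaming. *)
Lemma prf_allI_fresh G n c f :
    (forall g, List.In g G -> bound g <= c) -> bound f <= c ->
  prf G (inst n c f) -> prf G (All n f).
Proof.
move=> bG bf pf; apply: prf_allI.
(* [r] undoes the instantiation at [c], and on the assumptions, whose indices lie below [c], it is
   [shift n]. *)
pose r k i := if k == n then if i == c then 0 else i.+1 else i.
have := prf_ren r pf; have ->: ren r (inst n c f) = f.
  rewrite /inst ren_comp -[RHS]ren_id; apply: ren_ext_bound => k i lti.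
  rewrite /r; case: eqP => // _; case: i lti => [|i] lti; first by rewrite eqxx.
  by rewrite ltn_eqF // (leq_trans _ bf) // ltnW.
move=> /prf_weaken; apply=> g; rewrite !List.in_map_iff => -[h [<- hG]].
exists h; split=> //; apply: ren_ext_bound => k i lti.
by rewrite /r; case: eqP => // _; rewrite ltn_eqF // (leq_trans lti (bG _ hG)).
Qed.

Lemma prf_exfalso G f : prf G Bot -> prf G f.
Proof. by move=> pf; apply/prf_raa/(prf_weaken pf) => g; right. Qed.

End Provability.

(** * Henkin completeness *)

(** Carriers are always [nat], the set of variables of a type: countable structures
    suffice for completeness, and assignments are then the same thing as renamings. *)
Record structure (L : language) := Structure {
  eqn : nat -> nat -> nat -> Prop;
  prd : symbol L -> nat -> nat -> Prop
}.

(** * Satisfaction and soundness *)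

Section Semantics.
Variables (L : language) (S : structure L).
Implicit Types (f g : form L) (e : nat -> nat -> nat).

Fixpoint sat e f : Prop :=
  match f with
  | Bot => False
  | Imp f g => sat e f -> sat e g
  | All n f => forall a, sat (scons n a e) f
  | Eq n i j => eqn S n (e n i) (e n j)
  | Pred p i j => prd S p (e (type1 p) i) (e (type2 p) j)
  end.

Lemma sat_ext e e' f :
  (forall k i, e k i = e' k i) -> sat e f <-> sat e' f.
Proof.
elim: f e e' => [|f IHf g IHg|n f IHf|n i j|p i j] e e' //= ee'.
- by rewrite (IHf _ _ ee') (IHg _ _ ee').
- have ext a : sat (scons n a e) f <-> sat (scons n a e') f.
    by apply: IHf => k i; rewrite /scons; case: eqP; case: i => *; rewrite ?ee'.
  by split=> H a; apply/ext.
- by rewrite !ee'.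
- by rewrite !ee'.
Qed.

Lemma sat_ren e r f : sat e (ren r f) <-> sat (fun k i => e k (r k i)) f.
Proof.
elim: f e r => [|f IHf g IHg|n f IHf|n i j|p i j] e r //=.
  by rewrite IHf IHg.
have H a : sat (scons n a e) (ren (up n r) f)
       <-> sat (scons n a (fun k i => e k (r k i))) f.
  rewrite IHf; apply: sat_ext => k i.
  by rewrite /up /scons; case: (k =P n) => // _; case: i.
by split=> K a; apply/H.
Qed.

Lemma sat_idr e f : sat e f <-> sat idr (ren e f).
Proof. by rewrite sat_ren. Qed.

Lemma sat_shift n a e f : sat (scons n a e) (shift n f) <-> sat e f.
Proof.
by rewrite sat_ren; apply: sat_ext => k i; rewrite /scons; case: (k =P n).
Qed.

Lemma sat_scons_comm m n a b e f : (m == n) = false ->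
  sat (scons m a (scons n b e)) f <-> sat (scons n b (scons m a e)) f.
Proof.
move=> mn; apply: sat_ext => k i.
by rewrite /scons; case: (k =P m) => [->|//]; rewrite mn.
Qed.

Lemma sat_inst n a e f : sat e (inst n a f) <-> sat (scons n (e n a) e) f.
Proof.
rewrite sat_ren; apply: sat_ext => k i.
by rewrite /scons; case: (k =P n) => [->|//]; case: i.
Qed.

Lemma sat_Imp e f g : sat e (Imp f g) <-> (sat e f -> sat e g).
Proof. by []. Qed.

Lemma sat_All e n f : sat e (All n f) <-> forall a, sat (scons n a e) f.
Proof. by []. Qed.

Lemma sat_And e f g : sat e (And f g) <-> sat e f /\ sat e g.
Proof. rewrite /=; tauto. Qed.

Lemma sat_Iff e f g : sat e (Iff f g) <-> (sat e f <-> sat e g).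
Proof. rewrite /=; tauto. Qed.

Lemma sat_Ex e n f : sat e (Ex n f) <-> exists a, sat (scons n a e) f.
Proof.
split=> [H|[a Ha] /(_ a)]; last exact.
by apply: NNPP => K; apply: H => a Ha; apply: K; exists a.
Qed.

Lemma sat_bigAnd e (n : nat) (F : 'I_n -> form L) :
  sat e (\big[@And L/Top]_(i < n) F i) <-> forall i, sat e (F i).
Proof.
elim: n F => [|n IH] F; first by rewrite big_ord0; split=> // _ [].
rewrite big_ord_recl sat_And IH; split=> [[F0 FS] i|H].
  by case: (unliftP ord0 i) => [j ->|->].
by split=> [|i]; apply: H.
Qed.

End Semantics.

(** When the identity rules are in the logic, identity is asked to obey them, not to be equality on
    [nat]; so the variables themselves can form the term model. *)
Definition model (T : theory) (S : structure T) : Prop :=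
  (forall f, axiom f -> forall e, sat S e f) /\
  (identity_rules T ->
     (forall n a, eqn S n a a) /\
     (forall n a b e f, eqn S n a b ->
        sat S (scons n a e) f -> sat S (scons n b e) f)).

Lemma soundness (T : theory) (S : structure T) G (f : form T) :
  model S -> prf G f ->
  forall e, (forall g, List.In g G -> sat S e g) -> sat S e f.
Proof.
move=> [modA modE] pf; elim: pf => {G f}.
- by move=> G f fG e; apply.
- by move=> G f ax e _; apply: modA.
- by move=> G f g _ IH e HG Hf; apply: IH => h /= [<-|/HG].
- by move=> G f g _ IH1 _ IH2 e HG; apply: IH1 (IH2 _ HG).
- by move=> G f _ IH e HG; apply: NNPP => Hf; apply: (IH e) => h /= [<-|/HG].
- move=> G n f _ IH e HG a; apply: IH => g.
  by rewrite List.in_map_iff => -[h [<- /HG]]; rewrite sat_shift.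
- by move=> G n a f _ IH e HG; rewrite sat_inst; apply: IH.
- by move=> G n a /modE [Hr _] e _; apply: Hr.
- move=> G n a b f /modE [_ HE] _ IH1 _ IH2 e HG.
  have := IH2 _ HG; rewrite !sat_inst; apply: HE; exact: IH1.
Qed.

(** * Completeness by a maximal consistent extension *)

Section Completeness.
Variables (T : theory) (code : symbol T -> nat).
Hypotheses (code_inj : injective code) (T_ren : ren_closed T).
Implicit Types (f g : form T) (G : seq (form T)).

(** Generic trees over [nat] are countable in the library, so this makes formulas countable. *)
Fixpoint form_tree f : GenTree.tree nat :=
  match f with
  | Bot => GenTree.Node 0 [::]
  | Imp f g => GenTree.Node 1 [:: form_tree f; form_tree g]
  | All n f => GenTree.Node 2 [:: GenTree.Leaf n; form_tree f]
  | Eq n i j => GenTree.Node 3 [:: GenTree.Leaf n; GenTree.Leaf i; GenTree.Leaf j]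
  | Pred p i j =>
      GenTree.Node 4 [:: GenTree.Leaf (code p); GenTree.Leaf i; GenTree.Leaf j]
  end.

Lemma form_tree_inj : injective form_tree.
Proof.
elim=> [|f IHf g IHg|n f IHf|n i j|p i j] [|f' g'|n' f'|n' i' j'|p' i' j'] //=.
- by move=> [/IHf -> /IHg ->].
- by move=> [-> /IHf ->].
- by move=> [-> -> ->].
- by move=> [/code_inj -> -> ->].
Qed.

Definition form_code f : nat := pickle (form_tree f).

Lemma form_code_inj : injective form_code.
Proof. by move=> f g /(pcan_inj pickleK) /form_tree_inj. Qed.

Definition consistent G := ~ prf G Bot.

Definition fresh G : nat := foldr maxn 0 (map (@bound T) G).

Lemma bound_fresh G g : List.In g G -> bound g <= fresh G.
Proof.
rewrite /fresh; elim: G => //= h G IH [->|/IH le]; first exact: leq_maxl.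
by rewrite leq_max le orbT.
Qed.

Definition witness f G : seq (form T) :=
  match f with
  | Imp (All n g) Bot => [:: Neg (inst n (fresh (f :: G)) g)]
  | _ => [::]
  end.

(* Stages are finite, so a variable fresh for them serves as Henkin witness and the
   language need not be expanded. *)
Definition extend f G := witness f G ++ f :: G.

(** If the failing instance were refutable, [g] would hold of a fresh variable, hence [All n g]
    would follow, against its negation. *)
Lemma extend_consistent f G : consistent (f :: G) -> consistent (extend f G).
Proof.
rewrite /extend; case: f => // -[] // n g [] //= conG /prf_raa pf; apply: conG.
apply: prf_impE (prf_hyp _) _; first by left.
apply: prf_allI_fresh T_ren _ _ _ _ _ _ pf; first exact: bound_fresh.
by rewrite /fresh /= leq_max leq_max leqnn.
Qed.

Variable f0 : form T.

(** The formula coded by [k'], if there is one, is considered in passing to stage [k'.+1] and joins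
    when consistent with stage [k']. *)
Fixpoint stage k : seq (form T) :=
  if k is k'.+1 then
    match excluded_middle_informative
            (exists f, form_code f = k' /\ consistent (f :: stage k')) with
    | left ex =>
        extend (proj1_sig (constructive_indefinite_description _ ex)) (stage k')
    | right _ => stage k'
    end
  else [:: Neg f0].

Lemma stageS f : consistent (f :: stage (form_code f)) ->
  stage (form_code f).+1 = extend f (stage (form_code f)).
Proof.
move=> conf /=; case: excluded_middle_informative => [ex|[]]; last by exists f.
case: constructive_indefinite_description => g /= [/form_code_inj -> _] //.
Qed.

Lemma stage_consistent k : consistent [:: Neg f0] -> consistent (stage k).
Proof.
move=> con0; elim: k => //= k IH; case: excluded_middle_informative => // ex.
case: constructive_indefinite_description => g /= [_]; exact: extend_consistent.
Qed.

Lemma stage_mono k l g : k <= l -> List.In g (stage k) -> List.In g (stage l).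
Proof.
move=> /subnK <-; elim: (l - k) => //= d IH /IH {IH}.
case: excluded_middle_informative => // ex gk.
by apply: List.in_or_app; right; right.
Qed.

Definition complete_set f := exists k, List.In f (stage k).

Hypothesis con0 : consistent [:: Neg f0].

Lemma complete_set_stage G :
  (forall g, List.In g G -> complete_set g) ->
  exists k, forall g, List.In g G -> List.In g (stage k).
Proof.
elim: G => [|h G IH] HG; first by exists 0.
have [|k Hk] := IH; first by move=> g gG; apply: HG; right.
have [l Hl] := HG h (or_introl erefl).
exists (maxn k l) => g /= [<-|/Hk].
  exact: stage_mono (leq_maxr _ _) Hl.
exact: stage_mono (leq_maxl _ _).
Qed.

Lemma complete_set_consistent G :
  (forall g, List.In g G -> complete_set g) -> consistent G.
Proof.
move=> /complete_set_stage [k Hk] pf.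
exact: (stage_consistent (k := k) con0) (prf_weaken pf Hk).
Qed.

(** Finitely many members lie in one stage, so refuting [f] from its stage would make a stage
    inconsistent. The second conjunct locates where [f] enters, and thus its Henkin witness. *)
Lemma complete_set_in f G :
    (forall g, List.In g G -> complete_set g) -> prf G f ->
  complete_set f /\ consistent (f :: stage (form_code f)).
Proof.
move=> HG pf.
have con : consistent (f :: stage (form_code f)).
  move=> /prf_impI npf.
  apply: (@complete_set_consistent (G ++ stage (form_code f))).
    move=> g gG; have [/HG //|gk] := List.in_app_or _ _ _ gG.
    by exists (form_code f).
  apply: prf_impE (prf_weaken npf _) (prf_weaken pf _) => g gG.
    by apply: List.in_or_app; right.
  by apply: List.in_or_app; left.
split=> //; exists (form_code f).+1; rewrite stageS //.
by apply: List.in_or_app; right; left.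
Qed.

Lemma complete_set_prf f G :
  (forall g, List.In g G -> complete_set g) -> prf G f -> complete_set f.
Proof. by move=> HG /(complete_set_in HG) []. Qed.

(** Left out at its turn, [f] is refuted by its stage. *)
Lemma complete_set_neg f : ~ complete_set f -> complete_set (Neg f).
Proof.
move=> nf; apply: (@complete_set_prf _ (stage (form_code f))).
  by move=> g gk; exists (form_code f).
apply: prf_impI; apply: NNPP => con; apply: nf; exists (form_code f).+1.
by rewrite stageS //; apply: List.in_or_app; right; left.
Qed.

Lemma complete_set_bot : ~ complete_set Bot.
Proof.
move=> H; apply: (@complete_set_consistent [:: Bot]); last by apply: prf_hyp; left.
by move=> g /= [<-|].
Qed.

Lemma complete_set_imp f g :
  complete_set (Imp f g) <-> (complete_set f -> complete_set g).
Proof.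
split=> [Hfg Hf|H].
  apply: (@complete_set_prf _ [:: Imp f g; f]); first by move=> h /= [<-|[<-|]].
  by apply: prf_impE (prf_hyp _) (prf_hyp _); [left|right; left].
case: (classic (complete_set f)) => [/H Hg|/complete_set_neg Hf].
  apply: (@complete_set_prf _ [:: g]); first by move=> h /= [<-|].
  by apply/prf_impI/prf_hyp; right; left.
apply: (@complete_set_prf _ [:: Neg f]); first by move=> h /= [<-|].
apply/prf_impI/prf_exfalso.
by apply: prf_impE (prf_hyp _) (prf_hyp _); [right; left|left].
Qed.

Lemma complete_set_all n f :
  complete_set (All n f) <-> forall a, complete_set (inst n a f).
Proof.
split=> [Hf a|H].
  apply: (@complete_set_prf _ [:: All n f]); first by move=> h /= [<-|].
  by apply/prf_allE/prf_hyp; left.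
apply: NNPP => /complete_set_neg Hn.
have [| |_ con] := @complete_set_in (Neg (All n f)) [:: Neg (All n f)].
- by move=> h /= [<-|].
- by apply: prf_hyp; left.
(* [Neg (All n f)] entered at its own stage, and a failing instance with it. *)
set h := Neg (All n f) in con.
have : complete_set (Neg (inst n (fresh (h :: stage (form_code h))) f)).
  by exists (form_code h).+1; rewrite stageS //; left.
by move=> /complete_set_imp /(_ (H _)) /complete_set_bot.
Qed.

Definition henkin : structure T :=
  @Structure T (fun n i j => complete_set (Eq n i j))
               (fun p i j => complete_set (@Pred T p i j)).

(** The truth lemma: assignments into the term model are renamings, and extending one matches
    instantiating the renamed body. *)
Lemma sat_henkin e f : sat henkin e f <-> complete_set (ren e f).
Proof.
elim: f e => [|f IHf g IHg|n f IHf|n i j|p i j] e //=.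
- by split=> // /complete_set_bot.
- by rewrite complete_set_imp IHf IHg.
- rewrite complete_set_all; split=> H a; have := H a;
    by rewrite inst_ren_up IHf.
Qed.

Lemma model_henkin : model henkin.
Proof.
split=> [f ax e|idT].
  rewrite sat_henkin; apply: (@complete_set_prf _ [::]) => //.
  (* A renamed axiom is an axiom, so it holds under every assignment. *)
  exact/prf_axiom/T_ren.
split=> [n a|n a b e f ab].
  by apply: (@complete_set_prf _ [::]) => //; apply: prf_eqI.
rewrite !sat_henkin -!inst_ren_up => Ha.
apply: (@complete_set_prf _ [:: Eq n a b; inst n a (ren (up n e) f)]).
  by move=> h /= [<-|[<-|]].
by apply: (prf_eqE idT (prf_hyp _) (prf_hyp _)); [left|right; left].
Qed.

End Completeness.

Lemma completeness (T : theory) (code : symbol T -> nat) (f : form T) :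
    injective code -> ren_closed T ->
  (forall S : structure T, model S -> forall e, sat S e f) -> provable T f.
Proof.
move=> code_inj T_ren valid; apply: prf_raa; apply: NNPP => con.
have := valid _ (@model_henkin T code code_inj T_ren f con) idr.
rewrite sat_henkin // ren_id => Hf.
have [] : consistent [:: f; Neg f].
  apply: (@complete_set_consistent T code T_ren f con).
  by move=> g /= [<-|[<-|]] //; exists 0; left.
by apply: prf_impE (prf_hyp _) (prf_hyp _); [right; left|left].
Qed.

(** * Translations and pulled-back structures *)

Section Translate.
Variables (L1 L2 : language) (at_ : symbol L1 -> nat -> nat -> form L2).

Fixpoint translate (f : form L1) : form L2 :=
  match f with
  | Bot => Bot
  | Imp f g => Imp (translate f) (translate g)
  | All n f => All n (translate f)
  | Eq n i j => Eq n i j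
  | Pred p i j => at_ p i j
  end.

(** Under [idr] an element is the value of the index equal to it, so [at_ p a b] speaks of [a] and
    [b] themselves. *)
Definition pull (S : structure L2) : structure L1 :=
  @Structure L1 (eqn S) (fun p a b => sat S idr (at_ p a b)).

Hypothesis at_ren : forall r p i j,
  ren r (at_ p i j) = at_ p (r (type1 p) i) (r (type2 p) j).

Lemma translation_translate : translation translate.
Proof.
split=> // r f.
elim: f r => [|f IHf g IHg|n f IHf|n i j|p i j] r //=.
  by rewrite IHf IHg.
by rewrite IHf.
Qed.

Lemma sat_translate (S : structure L2) e f :
  sat S e (translate f) <-> sat (pull S) e f.
Proof.
elim: f e => [|f IHf g IHg|n f IHf|n i j|p i j] e //=.
- by rewrite IHf IHg.
- by split=> H a; apply/IHf.
- by rewrite sat_idr at_ren.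
Qed.

End Translate.

(** Completeness of [T2] turns the claim into truth in the pulled-back structures, and soundness of
    [T1] gives it there. *)
Lemma interpretation_translate (T1 T2 : theory) (code : symbol T2 -> nat)
    (at_ : symbol T1 -> nat -> nat -> form T2) :
    injective code -> ren_closed T2 ->
    (forall r p i j, ren r (at_ p i j) = at_ p (r (type1 p) i) (r (type2 p) j)) ->
    (forall S : structure T2, model S -> @model T1 (pull at_ S)) ->
  interpretation (T1 := T1) (T2 := T2) (translate at_).
Proof.
move=> code_inj T2_ren at_ren modS; split; first exact: translation_translate.
move=> f pf; apply: (completeness code_inj T2_ren) => S /modS modT1 e.
rewrite sat_translate //; exact: soundness modT1 pf _ _.
Qed.

(** Completeness of [T1] leaves a comparison of symbols in each model; identity is translated to
    itself. *)
Lemma provable_retranslate (T1 T2 : theory) (code : symbol T1 -> nat)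
    (at1 : symbol T1 -> nat -> nat -> form T2)
    (at2 : symbol T2 -> nat -> nat -> form T1) :
    injective code -> ren_closed T1 ->
    (forall r p i j, ren r (at1 p i j) = at1 p (r (type1 p) i) (r (type2 p) j)) ->
    (forall r p i j, ren r (at2 p i j) = at2 p (r (type1 p) i) (r (type2 p) j)) ->
    (forall S : structure T1, model S -> forall p a b,
       prd S p a b <-> prd (pull at1 (pull at2 S)) p a b) ->
  forall f : form T1, atomic f ->
    provable T1 (Iff f (translate at2 (translate at1 f))).
Proof.
move=> code_inj T1_ren at1_ren at2_ren equiv f atf.
apply: (completeness code_inj T1_ren) => S /equiv {}equiv e.
rewrite sat_Iff !sat_translate //.
by case: f atf => //= p i j _; exact: equiv.
Qed.

(** * The two translations *)

(** Junk value [Bot] unless [m < n]. *)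
Definition fapp (n m b a : nat) : form fjt_language :=
  if insub m is Some i then @fjt_app n i b a else Bot.

Lemma fappE n (i : 'I_n) b a : fapp n i b a = fjt_app i b a.
Proof. by rewrite /fapp valK. Qed.

Lemma ren_fapp r n m b a : ren r (fapp n m b a) = fapp n m (r n b) (r m a).
Proof. by rewrite /fapp; case: insubP => //= i _ <-. Qed.

(** The bound variables have types at most [n], so the indices [b] and [a], of higher types, are
    left unshifted. *)
Definition fjt_down (n b a : nat) : form fjt_language :=
  \big[@And fjt_language/Top]_(i < n.+1)
    All i (Iff (fapp n.+2 i b 0) (fapp n.+1 i a 0)).

Definition stt_to_fjt (p : symbol stt_language) : nat -> nat -> form fjt_language :=
  match p with App n => fapp n.+1 n | Down n => fjt_down n end.

(** The translation of b^n(a^m), with junk value [Bot] unless [m < n].  The variable [a]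
    needs no shift under the quantifier, which is reached only when [m] is not [n']. *)
Fixpoint sapp (n m b a : nat) : form stt_language :=
  if n is n'.+1 then
    if m == n' then stt_app n' b a
    else if n' is k.+1 then Ex n' (And (stt_down k b 0) (sapp n' m 0 a)) else Bot
  else Bot.

Definition fjt_to_stt (p : symbol fjt_language) : nat -> nat -> form stt_language :=
  sapp (projT1 p) (projT2 p).

Lemma ren_stt_to_fjt r p i j : ren r (stt_to_fjt p i j) =
  stt_to_fjt p (r (@type1 stt_language p) i) (r (@type2 stt_language p) j).
Proof.
case: p => n; rewrite /= ?ren_fapp // /fjt_down ren_bigAnd.
apply: eq_bigr => k _ /=; rewrite !ren_fapp /up eqxx.
by rewrite !gtn_eqF ?(leq_trans (ltn_ord k)).
Qed.

Lemma ren_sapp r n m b a : ren r (sapp n m b a) = sapp n m (r n b) (r m a).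
Proof.
elim: n r b => //= n IH r b; case: eqP => [->|/eqP mn] //=.
case: n IH mn => //= n IH mn; rewrite IH /up eqxx gtn_eqF // (negPf mn).
by [].
Qed.

Lemma ren_fjt_to_stt r p i j : ren r (fjt_to_stt p i j) =
  fjt_to_stt p (r (@type1 fjt_language p) i) (r (@type2 fjt_language p) j).
Proof. exact: ren_sapp. Qed.

(** * Countability of the languages and renaming of axioms *)

Definition stt_code (p : symbol stt_language) : nat :=
  pickle (match p with App n => inl n | Down n => inr n end : nat + nat)%type.

Lemma stt_code_inj : injective stt_code.
Proof. by case=> n [] m /(pcan_inj pickleK) // [->]. Qed.

Definition fjt_code (p : symbol fjt_language) : nat := pickle p.

Lemma fjt_code_inj : injective fjt_code.
Proof. exact: pcan_inj pickleK. Qed.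

Lemma ren_up_shift (L : language) m n r (f : form L) : (m == n) = false ->
  ren (up m (up n r)) (shift n f) = shift n (ren (up m r) f).
Proof.
move=> mn; rewrite -ren_shift; apply: ren_ext => k i; rewrite /up.
by case: (k =P m) => [->|_] //; rewrite mn.
Qed.

Lemma fjt_ren_closed : ren_closed FJT.
Proof.
move=> r _ [n phi n_gt0].
suff -> : ren r (Ex n (\big[@And fjt_language/Top]_(i < n)
     All i (Iff (fjt_app i 0 0) (shift n (phi i))))) =
  Ex n (\big[@And fjt_language/Top]_(i < n)
     All i (Iff (fjt_app i 0 0) (shift n (ren (up i r) (phi i))))).
  exact: fjt_comprehension.
rewrite /= ren_bigAnd; congr (Ex _ _); apply: eq_bigr => i _ /=.
by rewrite ren_up_shift ?ltn_eqF // /up !eqxx gtn_eqF ?eqxx.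
Qed.

Lemma eqSn n : (n.+1 == n) = false. Proof. exact: gtn_eqF. Qed.
Lemma eqnS n : (n == n.+1) = false. Proof. exact: ltn_eqF. Qed.
Lemma eqSSn n : (n.+2 == n) = false. Proof. exact/gtn_eqF/ltnW. Qed.
Lemma eqnSS n : (n == n.+2) = false. Proof. exact/ltn_eqF/ltnW. Qed.
Definition eq_natE := (eqxx, eqSS, eqSn, eqnS, eqSSn, eqnSS).

Lemma upE :
  (forall n r, up n r n 0 = 0) *
  (forall n r i, up n r n i.+1 = (r n i).+1) *
  (forall n r i, up n.+1 r n i = r n i) *
  (forall n r i, up n.+2 r n i = r n i) *
  (forall n r i, up n r n.+1 i = r n.+1 i) *
  (forall n r i, up n r n.+2 i = r n.+2 i).
Proof. by do !split=> *; rewrite /up ?eq_natE. Qed.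

Lemma stt_ren_closed : ren_closed STT_down.
Proof.
move=> r _ [n i j|phi|n phi|n|n|n] /=; rewrite ?ren_up_shift ?eq_natE ?upE //.
- exact: (stt_identity n (r n i) (r n j)).
- exact: (stt_comprehension0 (ren (up 0 r) phi)).
- exact: (stt_comprehension_down n (ren (up n.+1 (up n.+1 r)) phi)).
- exact: (stt_down_ex n).
- have := stt_down_sim n; rewrite /stt_approx; case: n => [|n] /=;
    by rewrite ?upE.
- have := stt_down_max n; rewrite /stt_approx; case: n => [|n] /=;
    by rewrite ?upE.
Qed.

Lemma sconsE :
  (forall n a e, scons n a e n 0 = a) *
  (forall n a e i, scons n a e n i.+1 = e n i) *
  (forall n a e i, scons n.+1 a e n i = e n i) *
  (forall n a e i, scons n.+2 a e n i = e n i) *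
  (forall n a e i, scons n a e n.+1 i = e n.+1 i) *
  (forall n a e i, scons n a e n.+2 i = e n.+2 i).
Proof. by do !split=> *; rewrite /scons ?eq_natE. Qed.

(** * Models of the two theories *)

Section SttModels.
Variable S : structure stt_language.
Hypothesis modS : @model STT_down S.
Local Notation A n := (@prd stt_language S (App n)).
Local Notation D n := (@prd stt_language S (Down n)).

Lemma sat_stt_app e n b a : sat S e (stt_app n b a) <-> A n (e n.+1 b) (e n a).
Proof. by []. Qed.

Lemma sat_stt_down e n b a : sat S e (stt_down n b a) <-> D n (e n.+2 b) (e n.+1 a).
Proof. by []. Qed.

Definition sim n x y := forall v, A n x v <-> A n y v.

Definition approx n x y :=
  if n is m.+1 then forall w, D m x w <-> D m y w else True.

Lemma sat_stt_sim e n a b : sat S e (stt_sim n a b) <-> sim n (e n.+1 a) (e n.+1 b).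
Proof.
rewrite sat_All; split=> H v; have := H v; by rewrite sat_Iff !sat_stt_app !sconsE.
Qed.

Lemma sat_stt_approx e n a b :
  sat S e (stt_approx n a b) <-> approx n (e n.+1 a) (e n.+1 b).
Proof.
case: n => [|n]; first by rewrite /=; tauto.
rewrite sat_All; split=> H v; have := H v; by rewrite sat_Iff !sat_stt_down !sconsE.
Qed.

(** Definability with parameters, which [e] supplies. *)
Definition definable n (P : nat -> Prop) :=
  exists phi e, forall x, P x <-> sat S (scons n x e) phi.

Lemma stt_eqn n a b : eqn S n a b <-> forall z, A n z a <-> A n z b.
Proof.
have := modS.1 _ (stt_identity n a b) idr; rewrite sat_Iff sat_All.
rewrite -[eqn S n a b]/(sat S idr (Eq n a b)) => ->.
split=> H z; have := H z; by rewrite sat_Iff !sat_stt_app !sconsE.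
Qed.

Lemma stt_comp0 P : definable 0 P -> exists z, forall x, A 0 z x <-> P x.
Proof.
move=> [phi [e P_phi]].
have /sat_Ex[z /sat_All Hz] := modS.1 _ (stt_comprehension0 phi) e.
exists z => x; have := Hz x; rewrite sat_Iff sat_stt_app !sconsE => ->.
by rewrite P_phi sat_scons_comm // sat_shift.
Qed.

Lemma stt_comp_down n P y : definable n.+1 P ->
  exists2 z, D n z y & forall x, A n.+1 z x <-> P x.
Proof.
move=> [phi [e P_phi]].
(* Index 1 of type [n.+1] is y in the axiom; [skip] moves the parameters of [phi] past it. *)
pose skip k i := if k == n.+1 then i.+1 else i.
have := modS.1 _ (stt_comprehension_down n (ren (up n.+1 skip) phi)) e.
rewrite sat_All => /(_ y) /sat_Ex [z].
rewrite sat_And sat_stt_down !sconsE sat_All => -[Dzy Hz].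
exists z => // x; have := Hz x; rewrite sat_Iff sat_stt_app !sconsE => ->.
rewrite sat_scons_comm ?eq_natE // sat_shift P_phi sat_ren; apply: sat_ext => k i.
by rewrite /up /scons /skip; case: (k =P n.+1) => [->|//]; case: i.
Qed.

Lemma stt_ex n z : exists x, D n z x.
Proof.
have := modS.1 _ (stt_down_ex n) idr.
rewrite sat_All => /(_ z) /sat_Ex [x].
by rewrite sat_stt_down !sconsE; exists x.
Qed.

(** Down_Sim and Down_Max together: the terms below [z] form one class under [sim] and [approx]. *)
Lemma stt_downP n z x y : D n z x -> D n z y <-> sim n x y /\ approx n y x.
Proof.
have := modS.1 _ (stt_down_sim n) idr; rewrite sat_All => /(_ z).
rewrite sat_All => /(_ x); rewrite sat_All => /(_ y).
rewrite sat_Imp !sat_And !sat_stt_down sat_stt_sim sat_stt_approx !sconsE => Sim.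
have := modS.1 _ (stt_down_max n) idr; rewrite sat_All => /(_ z).
rewrite sat_All => /(_ x); rewrite sat_All => /(_ y).
rewrite sat_Imp !sat_And !sat_stt_down sat_stt_sim sat_stt_approx !sconsE => Max.
tauto.
Qed.

(** Leibniz's law comes from comprehension: a term with the extension defined by [f] cannot separate
    [a] from [b]. *)
Lemma stt_leibniz n a b e f :
  eqn S n a b -> sat S (scons n a e) f -> sat S (scons n b e) f.
Proof.
rewrite stt_eqn => ab.
have [z Hz] : exists z, forall x, A n z x <-> sat S (scons n x e) f.
  have def : definable n (fun x => sat S (scons n x e) f) by exists f, e.
  case: n def {ab} => [|n] def; first exact: stt_comp0.
  by have [z _ Hz] := stt_comp_down 0 def; exists z.
by rewrite -!Hz ab.
Qed.

Definition J n m b a := sat S idr (sapp n m b a).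

Lemma sat_sapp e n m b a : sat S e (sapp n m b a) <-> J n m (e n b) (e m a).
Proof. by rewrite sat_idr ren_sapp. Qed.

Lemma J_app n b a : J n.+1 n b a <-> A n b a.
Proof. by rewrite /J /= eqxx. Qed.

Lemma J_down n m b a : m < n.+1 ->
  J n.+2 m b a <-> exists2 x, D n b x & J n.+1 m x a.
Proof.
move=> ltm; rewrite {1}/J.
have -> : sapp n.+2 m b a = Ex n.+1 (And (stt_down n b 0) (sapp n.+1 m 0 a)).
  by rewrite [LHS]/= ltn_eqF.
rewrite sat_Ex; split=> [[x]|[x Dx Jx]]; last exists x;
  rewrite sat_And sat_stt_down sat_sapp !sconsE.
  by rewrite /scons ltn_eqF // => -[Dx Jx]; exists x.
by rewrite /scons ltn_eqF.
Qed.

(** For [m = n] this is [sim]; for [m < n], [J] depends on [x] only through the terms below it,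
    which [approx] makes common. *)
Lemma J_sim_approx n m x y a : m < n.+1 -> sim n x y -> approx n y x ->
  J n.+1 m x a <-> J n.+1 m y a.
Proof.
rewrite ltnS leq_eqVlt => /predU1P[-> xy _|]; first by rewrite !J_app.
case: n => // n ltm _ yx; rewrite !J_down //.
by split=> -[w /yx Dw Jw]; exists w.
Qed.

(** All terms below [z] agree under [J], so the existential in [sapp] does not depend on the
    witness. *)
Lemma J_downE n m z x a : D n z x -> m < n.+1 ->
  J n.+2 m z a <-> J n.+1 m x a.
Proof.
move=> Dzx ltm; rewrite J_down //; split=> [[y Dzy]|]; last by exists x.
have [xy yx] := (stt_downP y Dzx).1 Dzy.
by rewrite (J_sim_approx a ltm xy yx).
Qed.

(** The recovery of ~> from application. Some [w] is below [z], and [x] is below [z] iff it is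
    related to [w] by [sim] and [approx]: [sim] is agreement at type [n], and [approx] follows by
    induction from agreement at lower types. *)
Lemma down_J n z x :
  D n z x <-> forall m, m < n.+1 -> forall a, J n.+2 m z a <-> J n.+1 m x a.
Proof.
elim: n z x => [|n IH] z x; split=> [Dzx m ltm a|H]; try exact: J_downE.
- have [w Dzw] := stt_ex 0 z; rewrite (stt_downP _ Dzw); split=> // v.
  by rewrite -!J_app -H // (J_downE _ Dzw).
- have [w Dzw] := stt_ex n.+1 z; rewrite (stt_downP _ Dzw); split=> /= v.
    by rewrite -!J_app -H // (J_downE _ Dzw).
  by rewrite !IH; split=> K m ltm a; rewrite -K // -H ?(J_downE _ Dzw) // ltnW.
Qed.

(** A term [y] carries the lower extensions; comprehension then gives a [z] above [y] with the top
    one, and [z] inherits the rest from [y]. *)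
Lemma J_comp n (P : nat -> nat -> Prop) :
    (forall i, i < n.+1 -> definable i (P i)) ->
  exists z, forall i, i < n.+1 -> forall x, J n.+1 i z x <-> P i x.
Proof.
elim: n => [|n IH] def.
  have [z Hz] := stt_comp0 (def 0 isT).
  by exists z => -[] // _ x; rewrite J_app.
have [y Hy] := IH (fun i lti => def i (ltnW lti)).
have [z Dzy Hz] := stt_comp_down y (def n.+1 (ltnSn _)).
exists z => i; rewrite ltnS leq_eqVlt => /predU1P[-> x|lti x].
  by rewrite J_app.
by rewrite (J_downE _ Dzy) // Hy.
Qed.

Lemma model_fjt_pull : @model FJT (pull fjt_to_stt S).
Proof.
split=> [_ [[//|n] phi _] e|_].
  pose psi i := if insub i is Some j then translate fjt_to_stt (phi j) else Bot.
  have [|z Hz] := @J_comp n (fun i x => sat S (scons i x e) (psi i)).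
    by move=> i _; exists (psi i), e.
  rewrite sat_Ex; exists z; rewrite sat_bigAnd => i; rewrite sat_All => x.
  rewrite sat_Iff.
  have -> : sat (pull fjt_to_stt S) (scons i x (scons n.+1 z e)) (fjt_app i 0 0)
    <-> J n.+1 i z x.
    rewrite -[sat _ _ _]/(J n.+1 i (scons i x (scons n.+1 z e) n.+1 0)
                            (scons i x (scons n.+1 z e) i 0)).
    by rewrite /scons !eqxx gtn_eqF.
  rewrite sat_scons_comm ?ltn_eqF // sat_shift Hz // /psi valK.
  by rewrite (sat_translate ren_fjt_to_stt).
split=> [n a|n a b e f ab]; first exact/stt_eqn.
by rewrite -!(sat_translate ren_fjt_to_stt); apply: stt_leibniz.
Qed.

End SttModels.

Lemma sat_pull_fapp (S : structure stt_language) e n m b a : m < n ->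
  sat (pull fjt_to_stt S) e (fapp n m b a) <-> J S n m (e n b) (e m a).
Proof.
by move=> ltm; rewrite -[m]/(val (Ordinal ltm)) fappE.
Qed.

(** * From models of [FJT] to models of [STT_down] *)

Section FjtModels.
Variable S : structure fjt_language.
Hypothesis modS : @model FJT S.

Definition app_rel n m b a := sat S idr (fapp n m b a).
Local Notation B := app_rel.

Definition down_rel n b a :=
  forall i, i < n.+1 -> forall v, B n.+2 i b v <-> B n.+1 i a v.

Lemma sat_fapp e n m b a : sat S e (fapp n m b a) <-> B n m (e n b) (e m a).
Proof. by rewrite sat_idr ren_fapp. Qed.

Lemma sat_fjt_down e n b a :
  sat S e (fjt_down n b a) <-> down_rel n (e n.+2 b) (e n.+1 a).
Proof.
have atom (i : 'I_n.+1) v :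
  sat S (scons i v e) (Iff (fapp n.+2 i b 0) (fapp n.+1 i a 0)) <->
  (B n.+2 i (e n.+2 b) v <-> B n.+1 i (e n.+1 a) v).
  rewrite sat_Iff !sat_fapp /scons !eqxx !gtn_eqF //.
  exact: ltnW (ltn_ord i).
rewrite sat_bigAnd; split=> [H i lti v|H i].
  by have := H (Ordinal lti); rewrite sat_All => /(_ v) /atom.
by rewrite sat_All => v; apply/atom/H.
Qed.

Lemma fjt_comp n (phi : nat -> form fjt_language) e : 0 < n ->
  exists z, forall i, i < n -> forall x,
    B n i z x <-> sat S (scons i x e) (phi i).
Proof.
move=> n_gt0.
have := modS.1 _ (fjt_comprehension (fun i : 'I_n => phi i) n_gt0) e.
rewrite sat_Ex => -[z]; rewrite sat_bigAnd => Hz; exists z => i lti x.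
have := Hz (Ordinal lti); rewrite sat_All => /(_ x); rewrite sat_Iff -fappE.
rewrite sat_fapp sat_scons_comm ?sat_shift ?ltn_eqF //=.
by rewrite /scons !eqxx gtn_eqF.
Qed.

(** Comprehension truncates [z] to its extensions at types up to [n]. *)
Lemma fjt_ex n z : exists x, down_rel n z x.
Proof.
have [x Hx] := @fjt_comp n.+1 (fun i => fapp n.+2 i z 0) idr isT.
exists x => i lti v; rewrite Hx // sat_fapp /scons eqxx gtn_eqF //.
exact: ltnW.
Qed.

Lemma fjt_eqn n a b :
  eqn S n a b <-> forall z, B n.+1 n z a <-> B n.+1 n z b.
Proof.
have [refl leib] := modS.2 erefl; split=> [ab z|H].
  have := leib n a b (scons n a idr) (Iff (fapp n.+1 n z 1) (fapp n.+1 n z 0)) ab.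
  by rewrite !sat_Iff !sat_fapp !sconsE; apply.
(* At type [n] this [z] holds exactly of what is identical to [a], so [H z] puts [b] in it. *)
have [z Hz] := @fjt_comp n.+1 (fun _ => Eq n 1 0) (scons n a idr) isT.
have := (H z).1; rewrite !Hz // /= !sconsE; apply; exact: refl.
Qed.

Local Notation P := (pull stt_to_fjt S).

Lemma down_pull n b a : @prd stt_language P (Down n) b a <-> down_rel n b a.
Proof. exact: sat_fjt_down. Qed.

(** Down_Sim and Down_Max for the pulled-back structure. Two truncations of [z] agree at all types
    up to [n]; conversely [sim] gives agreement at type [n] and [approx] below it. *)
Lemma down_pullP n z x y : down_rel n z x ->
  down_rel n z y <-> sim P n x y /\ approx P n y x.
Proof.
move=> zx; split=> [zy|[xy yx] i].
  have xy i v : i < n.+1 -> B n.+1 i x v <-> B n.+1 i y v.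
    by move=> lti; rewrite -zx // zy.
  split=> [v|]; first exact: xy.
  case: n {zx zy} xy => // n xy w; rewrite !down_pull.
  by split=> H i lti v; rewrite -H // xy // ltnW.
rewrite ltnS leq_eqVlt => /predU1P[-> v|]; first by rewrite zx //; exact: xy.
case: n z x y zx xy yx => // n z x y zx _ yx lti v.
(* A truncation [w] of [y] is, by [approx], one of [x] too, so [x] and [y] agree at the lower types
   through [w]. *)
have [w yw] := fjt_ex n y.
have xw : down_rel n x w by rewrite -down_pull -yx down_pull.
by rewrite zx ?(xw i) ?(yw i) // ltnW.
Qed.

Lemma model_stt_pull : @model STT_down P.
Proof.
split=> // _ [n i j|phi|n phi|n|n|n] e.
- rewrite sat_Iff sat_All.
  rewrite -[sat _ _ (Eq n i j)]/(eqn S n (e n i) (e n j)) fjt_eqn.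
  by split=> H z; have := H z; rewrite sat_Iff !sat_stt_app !sconsE.
- have [z Hz] := @fjt_comp 1 (fun _ => translate stt_to_fjt phi) e isT.
  rewrite sat_Ex; exists z; rewrite sat_All => x.
  rewrite sat_Iff sat_stt_app !sconsE sat_scons_comm // sat_shift.
  by rewrite -(sat_translate ren_stt_to_fjt); exact: Hz.
- rewrite sat_All => y.
  (* [z] copies the lower extensions of [y] and takes [phi] at the top type. *)
  have [z Hz] := @fjt_comp n.+2
    (fun i => if i < n.+1 then fapp n.+1 i 0 0 else translate stt_to_fjt phi)
    (scons n.+1 y e) isT.
  rewrite sat_Ex; exists z; rewrite sat_And sat_stt_down !sconsE; split.
    apply/down_pull => i lti v; rewrite Hz ?lti ?sat_fapp; last exact: ltnW.
    by rewrite /scons !eqxx gtn_eqF.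
  rewrite sat_All => x; rewrite sat_Iff sat_stt_app !sconsE.
  rewrite sat_scons_comm ?eq_natE // sat_shift -(sat_translate ren_stt_to_fjt).
  by have := Hz n.+1 (ltnSn _) x; rewrite ltnn.
- rewrite sat_All => z; rewrite sat_Ex; have [x zx] := fjt_ex n z.
  by exists x; rewrite sat_stt_down !sconsE; apply/down_pull.
- rewrite sat_All => z; rewrite sat_All => x; rewrite sat_All => y.
  rewrite sat_Imp !sat_And !sat_stt_down sat_stt_sim sat_stt_approx !sconsE.
  by rewrite !down_pull => -[zx /(down_pullP _ zx)].
- rewrite sat_All => z; rewrite sat_All => x; rewrite sat_All => y.
  rewrite sat_Imp !sat_And !sat_stt_down sat_stt_sim sat_stt_approx !sconsE.
  by rewrite !down_pull => -[zx /(down_pullP _ zx)].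
Qed.

(** Every truncation of [b] agrees with [b] at lower types, and one exists, so the descent in [sapp]
    computes application. *)
Lemma J_pull n m b a : m < n -> J P n m b a <-> B n m b a.
Proof.
elim: n b => // n IH b; rewrite ltnS leq_eqVlt => /predU1P[->|ltm].
  by rewrite J_app.
case: n IH ltm => // n IH ltm; rewrite J_down //; split=> [[x]|Bba].
  by rewrite down_pull IH // => bx; rewrite bx.
have [x bx] := fjt_ex n b.
by exists x; rewrite ?down_pull ?IH // -bx.
Qed.

End FjtModels.

(** * The definitional equivalence *)

Theorem theoremD8 : definitionally_equivalent STT_down FJT.
Proof.
exists (translate stt_to_fjt), (translate fjt_to_stt); split.
- apply: (@interpretation_translate STT_down FJT _ _
    fjt_code_inj fjt_ren_closed ren_stt_to_fjt).
  exact: model_stt_pull.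
- apply: (@interpretation_translate FJT STT_down _ _
    stt_code_inj stt_ren_closed ren_fjt_to_stt).
  exact: model_fjt_pull.
- apply: (@provable_retranslate STT_down FJT _ _ _
    stt_code_inj stt_ren_closed ren_stt_to_fjt ren_fjt_to_stt).
  move=> S modS [] n a b.
    rewrite -[prd (pull _ _) _ _ _]/(sat (pull fjt_to_stt S) idr (fapp n.+1 n a b)).
    by rewrite sat_pull_fapp // J_app.
  (* The composite translation of ~> is agreement under [J] at the types below that of x, so
     [down_J] applies. *)
  rewrite down_pull (down_J modS); split=> H i lti v.
    by rewrite /app_rel !sat_pull_fapp ?H // ltnW.
  by have := H i lti v; rewrite /app_rel !sat_pull_fapp // ltnW.
- apply: (@provable_retranslate FJT STT_down _ _ _
    fjt_code_inj fjt_ren_closed ren_fjt_to_stt ren_stt_to_fjt).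
  move=> S modS [n i] b a.
  rewrite -[prd (pull _ _) _ _ _]/(J (pull stt_to_fjt S) n i b a).
  by rewrite (J_pull modS) // /app_rel fappE.
Qed.
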